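(* Let $q\in\mathbb{C}^*$, $|q|<1$, $E=E_q=\mathbb{C}^*/q^{\mathbb{Z}}$, $\eta\in\mathbb{C}^*$, $k\geq 1$, and $x\in\mathcal{R}$ a holomorphic function on $\mathbb{C}^*$. Consider the $\mathrm{SL}_2$-parabolic bundle $\xi$ given by the extension $0\to\xi_0^*\to V\to\xi_0\to0$ with multiplier $\begin{pmatrix}(\eta z)^{-k}&0\\(\eta z)^kx&(\eta z)^k\end{pmatrix}$. Then the Poisson bivector of the moduli space of parabolic bundles at $\xi$ is the composition $$B^\#:\ H^0(E,\mathfrak{p}_-(\xi))\xrightarrow{\ \tau\ }H^0(E,\mathfrak{u}_-(\xi))\xrightarrow{\ \delta\ }H^1(E,\mathfrak{p}(\xi)),$$ $$\begin{pmatrix}a&b'\\0&-a\end{pmatrix}\mapsto\begin{pmatrix}0&b'\\0&0\end{pmatrix}\mapsto\left[\begin{matrix}0&0\\(b'x-2a)x&0\end{matrix}\right].$$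
   Context: $\mathcal{R}$ is the ring of holomorphic functions on $\mathbb{C}^*$, $f_q(z):=f(qz)$. A multiplier $A\in L\mathrm{GL}_N$ (a holomorphic map $\mathbb{C}^*\to \mathrm{GL}_N$) defines the vector bundle on $E_q$ whose sections over an open set are the holomorphic row vectors $\mathbf f$ on its preimage in $\mathbb{C}^*$ with $\phi(\mathbf f):=\mathbf f(qz)A(z)=\mathbf f(z)$; its cohomology is $H^0=\ker(\phi-1)$, $H^1=\mathrm{coker}(\phi-1)$ on $\mathcal{R}^N$. $\xi_0$ is the degree $k$ line bundle with multiplier $(\eta z)^k$. $\mathfrak{g}(\xi)=\underline{\mathrm{End}}_0(V)$ is the bundle of traceless endomorphisms of $V$; an element is written $\begin{pmatrix}a&b\\c&d\end{pmatrix}$, $d=-a$, with $a,b,c,d$ the coordinates along $e_1^*\otimes e_1,\ e_1^*\otimes e_2,\ e_2^*\otimes e_1,\ e_2^*\otimes e_2$, where $(e_1,e_2)$ is the standard basis. $\underline{\mathrm{End}}(V)$ has multiplier $$\begin{pmatrix}1&0&-x&0\\(\eta z)^{2k}x&(\eta z)^{2k}&-(\eta z)^{2k}x^2&-(\eta z)^{2k}x\\0&0&(\eta z)^{-2k}&0\\0&0&x&1\end{pmatrix}$$ acting on row vectors $(a,b,c,d)$. $\mathfrak{p}(\xi)\subset\mathfrak{g}(\xi)$ is the subsheaf $b=0$ (flag-preserving), $\mathfrak{u}(\xi)$ the subsheaf $a=b=d=0$, $\mathfrak{p}_-(\xi)=\mathfrak{g}(\xi)/\mathfrak{u}(\xi)$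 (ignore $c$), $\mathfrak{u}_-(\xi)=\mathfrak{g}(\xi)/\mathfrak{p}(\xi)$ (only $b$). Thus $H^0(E,\mathfrak{p}_-(\xi))$ consists of $\begin{pmatrix}a&b'\\0&-a\end{pmatrix}$ with $(\eta z)^{2k}b'_q=b'$ and $a_q-a=-b'x$. The Poisson bivector is by definition $B^\#=\delta\circ\tau$, where $\tau$ is induced by the projection $\mathfrak{p}_-(\xi)\to\mathfrak{u}_-(\xi)$ and $\delta$ is the connecting map of $0\to\mathfrak{p}(\xi)\to\mathfrak{g}(\xi)\to\mathfrak{u}_-(\xi)\to0$. Brackets $[\ \cdot\ ]$ denote the class in $H^1(E,\mathfrak{p}(\xi))$. The second arrow of the displayed formula is evaluated on the image of $\tau$, with $a$ as in the first matrix. *)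

(* Defs.v *)
From HB Require Import structures.
From mathcomp Require Import all_boot all_order all_algebra.
From mathcomp Require Import all_classical all_reals all_analysis.
From mathcomp Require Import complex ring.

Set Implicit Arguments.
Unset Strict Implicit.
Unset Printing Implicit Defensive.

Import Order.TTheory GRing.Theory Num.Theory numFieldNormedType.Exports.
Import Quotient.

Local Open Scope ring_scope.
Local Open Scope quotient_scope.

Section SubZ.
Variables (V : zmodType) (S : zmodClosed V).

Record subz := SubZ { subz_val :> V; subz_mem : subz_val \in S }.

HB.instance Definition _ := [isSub for subz_val].
HB.instance Definition _ := [Choice of subz by <:].
HB.instance Definition _ := [SubChoice_isSubZmodule of subz by <:].

End SubZ.

(* A vector bundle on E_q = C^* / q^Z enters through the additive group of    *)
(* all sections over C^* of its pullback, with the operator phi whose fixed   *)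
(* points are the sections over E_q. Only the additive structure of the       *)
(* cohomology groups is recorded.                                             *)
Record phimod := PhiMod { phi_sort :> zmodType; phi : {additive phi_sort -> phi_sort} }.
Arguments phi : clear implicits.

Section Cohomology.
Variable M : phimod.

Definition fixed : {pred M} := [pred m : M | phi M m == m].

Lemma fixed_zmod_closed : zmod_closed fixed.
Proof.
split=> [|u v]; first by rewrite inE raddf0.
by rewrite !inE => /eqP eu /eqP ev; rewrite raddfB eu ev.
Qed.
HB.instance Definition _ := GRing.isZmodClosed.Build M fixed fixed_zmod_closed.

Definition coboundary : {pred M} := [pred m : M | `[< exists n : M, m = phi M n - n >]].

Lemma coboundary_zmod_closed : zmod_closed coboundary.
Proof.
split=> [|u v]; first by apply/asboolP; exists 0; rewrite raddf0 subr0.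
move=> /asboolP[m ->] /asboolP[n ->]; apply/asboolP; exists (m - n).
by rewrite (raddfB (phi M)) !opprD !opprK addrACA.
Qed.
HB.instance Definition _ :=
  GRing.isZmodClosed.Build M coboundary coboundary_zmod_closed.

(* ker (phi - 1) and coker (phi - 1) *)
Definition H0 : zmodType := subz fixed.
Definition H1 : zmodType := {quot coboundary}.
Definition H1_class (m : M) : H1 := \pi_{quot coboundary} m.

End Cohomology.

Section SubQuotient.
Variable M : phimod.

Record submod := SubMod {
  sub_pred :> zmodClosed M;
  sub_stable : forall m, m \in sub_pred -> phi M m \in sub_pred }.

Variable S : submod.

Definition sub_phi (m : subz S) : subz S := SubZ (sub_stable (subz_mem m)).

Lemma sub_phi_additive : zmod_morphism sub_phi.
Proof. by move=> u v; apply: val_inj; rewrite /= !raddfB. Qed.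
HB.instance Definition _ :=
  GRing.isZmodMorphism.Build (subz S) (subz S) sub_phi sub_phi_additive.

Definition sub_phimod : phimod := @PhiMod (subz S) sub_phi.

Definition quot_phi (x : {quot S}) : {quot S} := \pi_{quot S} (phi M (repr x)).

Lemma quot_phi_pi (m : M) : quot_phi (\pi_{quot S} m) = \pi_{quot S} (phi M m).
Proof.
apply/eqP; rewrite /quot_phi -idealrBE -raddfB /=; apply: sub_stable.
by rewrite idealrBE reprK.
Qed.

Lemma quot_phi_additive : zmod_morphism quot_phi.
Proof.
move=> u v; rewrite -[u]reprK -[v]reprK -raddfB /= !quot_phi_pi -raddfB /=.
by rewrite raddfB.
Qed.
HB.instance Definition _ :=
  GRing.isZmodMorphism.Build {quot S} {quot S} quot_phi quot_phi_additive.

Definition quot_phimod : phimod := @PhiMod {quot S} quot_phi.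

Definition quot_class (m : M) : quot_phimod := \pi_{quot S} m.

(* The connecting map H^0(M/S) -> H^1(S) of 0 -> S -> M -> M/S -> 0: lift to  *)
(* M, apply phi - 1, and take the class of the result in H^1(S).              *)
Lemma connecting_mem (s : H0 quot_phimod) :
  phi M (repr (\val s)) - repr (\val s) \in S.
Proof.
rewrite idealrBE; case: s => s /= /eqP hs.
by rewrite reprK; apply/eqP; rewrite -[RHS]hs.
Qed.

Definition connecting (s : H0 quot_phimod) : H1 sub_phimod :=
  @H1_class sub_phimod (SubZ (connecting_mem s)).

End SubQuotient.

Section QuotientMap.
Variables (M : phimod) (S T : submod M).
Hypothesis sub_ST : {subset S <= T}.

Definition quot_proj (x : quot_phimod S) : quot_phimod T :=
  quot_class T (repr (x : {quot S})).

Lemma quot_proj_class (m : M) : quot_proj (quot_class S m) = quot_class T m.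
Proof.
by apply/eqP; rewrite /quot_proj /quot_class -idealrBE sub_ST// idealrBE reprK.
Qed.

Lemma quot_proj_fixed (s : H0 (quot_phimod S)) :
  quot_proj (\val s) \in @fixed (quot_phimod T).
Proof.
case: s => s /= /eqP hs; apply/eqP.
rewrite [LHS]quot_phi_pi -[LHS]quot_proj_class -[RHS]/(quot_proj s).
by congr quot_proj; rewrite -[RHS]hs.
Qed.

Definition H0_proj (s : H0 (quot_phimod S)) : H0 (quot_phimod T) :=
  SubZ (quot_proj_fixed s).

End QuotientMap.

Section Holomorphic.
Variable R : realType.
Local Notation C := R[i].

Record Cstar := MkCstar { Cstar_val :> C; Cstar_neq0 : Cstar_val != 0 }.

HB.instance Definition _ := [isSub for Cstar_val].
HB.instance Definition _ := [Choice of Cstar by <:].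

Definition Cstar1 : Cstar := MkCstar (oner_neq0 C).
HB.instance Definition _ := isPointed.Build Cstar Cstar1.

Definition Cstar_mul (z w : Cstar) : Cstar :=
  MkCstar (mulf_neq0 (Cstar_neq0 z) (Cstar_neq0 w)).

(* Complex differentiability is asked at nonzero points only, so that the     *)
(* value of the extension at 0 is irrelevant.                                 *)
Definition extend0 (f : Cstar -> C) (w : C^o) : C^o := oapp f 0 (insub w).

Definition holomorphic : {pred Cstar -> C} :=
  [pred f | `[< forall z : Cstar, derivable (extend0 f) (z : C^o) 1 >]].

Lemma extend0E (f : Cstar -> C) (z : Cstar) : extend0 f z = f z.
Proof. by rewrite /extend0 valK. Qed.

Lemma extend0_sub (f g : Cstar -> C) : extend0 (f - g) = extend0 f - extend0 g.
Proof.
by apply/funext => w /=; rewrite /extend0 !fctE /=; case: insubP => [z _ _|_] /=; rewrite ?fctE ?subr0.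
Qed.

Lemma extend0_mul (f g : Cstar -> C) : extend0 (f * g) = extend0 f * extend0 g.
Proof.
by apply/funext => w /=; rewrite /extend0 !fctE /=; case: insubP => [z _ _|_] /=; rewrite ?fctE ?mulr0.
Qed.

Lemma near_Cstar (z : Cstar) : \forall w \near nbhs (z : C^o), w != 0.
Proof.
have nz : (z : C^o) != 0 by exact: Cstar_neq0.
by apply: (@cvgr_neq0 _ C^o _ (nbhs (z : C^o)) _ id z) => //; exact: cvg_id.
Qed.

Lemma holomorphic_subring_closed : subring_closed holomorphic.
Proof.
split=> [|f g /asboolP hf /asboolP hg|f g /asboolP hf /asboolP hg];
  apply/asboolP => z.
- apply: (@near_eq_derivable C C^o C^o (cst 1)); last exact: derivable_cst.
  near=> w.
  have w0 : w != 0 by near: w; exact: near_Cstar.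
  by rewrite /extend0 /= insubT.
- by rewrite extend0_sub; apply: derivableB.
- by rewrite extend0_mul; apply: derivableM.
Unshelve. all: by end_near.
Qed.
HB.instance Definition _ :=
  GRing.isSubringClosed.Build (Cstar -> C) holomorphic holomorphic_subring_closed.

Record hol := Hol { hol_fun :> Cstar -> C; holP : hol_fun \in holomorphic }.

HB.instance Definition _ := [isSub for hol_fun].
HB.instance Definition _ := [Choice of hol by <:].
HB.instance Definition _ := [SubChoice_isSubComNzRing of hol by <:].

Lemma hol_eq (f g : hol) : hol_fun f =1 hol_fun g -> f = g.
Proof. by move=> fg; apply: val_inj; exact/funext. Qed.

Lemma holD (f g : hol) z : (f + g) z = f z + g z. Proof. by []. Qed.
Lemma holN (f : hol) z : (- f) z = - f z. Proof. by []. Qed.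
Lemma holM (f g : hol) z : (f * g) z = f z * g z. Proof. by []. Qed.
Lemma hol1 z : (1 : hol) z = 1. Proof. by []. Qed.

(* The units of the ring are the nowhere vanishing functions. *)
Definition hol_unit : pred hol := [pred f : hol | `[< forall z, f z != 0 >]].

Lemma hol_inv_subproof (f : hol) :
  f \in hol_unit -> (fun z => (f z)^-1) \in holomorphic.
Proof.
move=> /asboolP f0; apply/asboolP => z.
apply: (@near_eq_derivable C C^o C^o (fun w => (extend0 f w)^-1)); last first.
  apply: derivableV; first by rewrite extend0E.
  by have /asboolP := holP f; apply.
near=> w; rewrite /extend0 /=; case: insubP => [//|_] /=.
by rewrite invr0.
Unshelve. all: by end_near.
Qed.

Definition hol_inv (f : hol) : hol :=
  if pselect (f \in hol_unit) is left fu then Hol (hol_inv_subproof fu) else f.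

Lemma hol_invE (f : hol) z : f \in hol_unit -> hol_inv f z = (f z)^-1.
Proof. by rewrite /hol_inv; case: pselect. Qed.

Lemma hol_mulVr : {in hol_unit, left_inverse 1 hol_inv *%R}.
Proof.
move=> f fu; apply: hol_eq => z; rewrite holM hol1 hol_invE// mulVf//.
by have /asboolP := fu; apply.
Qed.

Lemma hol_unitP (f g : hol) : g * f = 1 -> f \in hol_unit.
Proof.
move=> gf; apply/asboolP => z; apply/eqP => fz.
have := congr1 (fun h : hol => h z) gf.
by rewrite holM hol1 fz mulr0 => /esym/eqP; rewrite oner_eq0.
Qed.

Lemma hol_inv_out : {in [predC hol_unit], hol_inv =1 id}.
Proof. by move=> f; rewrite inE => fu; rewrite /hol_inv; case: pselect => // fu'; case/negP: fu. Qed.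

HB.instance Definition _ :=
  GRing.ComNzRing_hasMulInverse.Build hol hol_mulVr hol_unitP hol_inv_out.

Section Shift.
Variable q : Cstar.

Lemma qshift_subproof (f : hol) : (fun z => f (Cstar_mul q z)) \in holomorphic.
Proof.
apply/asboolP => z.
have -> : extend0 (fun z => f (Cstar_mul q z)) =
          extend0 f \o (fun w : C^o => (q : C) * w : C^o).
  apply/funext => w; rewrite /extend0 /=.
  case: insubP => [u u0 uw|/negbNE/eqP ->] /=; last first.
    by rewrite mulr0 insubF// eqxx.
  rewrite -uw.
  have -> : (q : C) * \val u = \val (Cstar_mul q u) by [].
  by rewrite valK.
apply/derivable1_diffP; apply: differentiable_comp.
  by apply/derivable1_diffP; apply: derivableM; [exact: derivable_cst|exact: derivable_id].
by apply/derivable1_diffP; have /asboolP /(_ (Cstar_mul q z)) := holP f.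
Qed.

(* f_q(z) = f(qz) *)
Definition qshift (f : hol) : hol := Hol (qshift_subproof f).

Lemma qshift_zmod_morphism : zmod_morphism qshift.
Proof. by move=> f g; apply: hol_eq. Qed.
HB.instance Definition _ := GRing.isZmodMorphism.Build hol hol qshift qshift_zmod_morphism.

Lemma qshift_monoid_morphism : monoid_morphism qshift.
Proof. by split=> [|f g]; apply: hol_eq. Qed.
HB.instance Definition _ := GRing.isMonoidMorphism.Build hol hol qshift qshift_monoid_morphism.

End Shift.

Lemma zscale_subproof (eta : Cstar) : (fun z : Cstar => (eta : C) * z) \in holomorphic.
Proof.
apply/asboolP => z.
apply: (@near_eq_derivable C C^o C^o (fun w => (eta : C) * w)); last first.
  by apply: derivableM; [exact: derivable_cst|exact: derivable_id].
near=> w; rewrite /extend0 /=; case: insubP => [u _ <- //|/negbNE/eqP ->] /=.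
by rewrite mulr0.
Unshelve. all: by end_near.
Qed.

(* z |-> eta z *)
Definition zscale (eta : Cstar) : hol := Hol (zscale_subproof eta).

Lemma zscale_unit (eta : Cstar) : zscale eta \is a GRing.unit.
Proof. by apply/asboolP => z; apply: mulf_neq0; exact: Cstar_neq0. Qed.

End Holomorphic.

Section Bundles.
Variables (R : realType) (q : Cstar R).
Local Notation hol := (hol R).

(* LGL_N: a matrix over the ring of holomorphic functions is a unit iff its   *)
(* determinant vanishes nowhere, i.e. iff it is a map from C^* to GL_N.       *)
Record LGL (N : nat) := MkLGL { LGL_mx :> 'M[hol]_N; LGL_unit : LGL_mx \in unitmx }.

Section Bundle.
Variables (N : nat) (A : LGL N).

Definition bundle_phi (f : 'rV[hol]_N) : 'rV[hol]_N := map_mx (qshift q) f *m A.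

Lemma bundle_phi_additive : zmod_morphism bundle_phi.
Proof. by move=> f g; rewrite /bundle_phi map_mxB mulmxBl. Qed.
HB.instance Definition _ :=
  GRing.isZmodMorphism.Build _ _ bundle_phi bundle_phi_additive.

Definition bundle : phimod := @PhiMod 'rV[hol]_N bundle_phi.

(* Multiplier of End(V) = V^* (x) V: in the coordinates e_i^* (x) e_j, read   *)
(* row by row, the endomorphism with matrix m goes to A^-1 m_q A.             *)
Definition End_mx : 'M[hol]_(N * N) :=
  lin_mx (mulmxr A \o mulmx (invmx A)).

Lemma End_mxE (m : 'M[hol]_N) : mxvec m *m End_mx = mxvec (invmx A *m m *m A).
Proof. by rewrite mul_vec_lin. Qed.

Lemma End_mx_unit : End_mx \in unitmx.
Proof.
pose B : 'M[hol]_(N * N) := lin_mx (mulmxr (invmx A) \o mulmx A).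
suff /mulmx1_unit[] : End_mx *m B = 1%:M by [].
apply/row_matrixP => i; rewrite row_mul !rowE.
case/mxvec_indexP: i => i j.
rewrite -mxvec_delta End_mxE mul_vec_lin /= mulmx1.
by rewrite !mulmxA mulmxV ?LGL_unit// mul1mx mulmxK ?LGL_unit.
Qed.

Definition End_mult : LGL (N * N) := MkLGL End_mx_unit.
End Bundle.

Lemma phi_EndE N (A : LGL N) (m : bundle (End_mult A)) :
  vec_mx (phi (bundle (End_mult A)) m) =
    invmx A *m map_mx (qshift q) (vec_mx m) *m A.
Proof.
have -> : phi (bundle (End_mult A)) m =
    map_mx (qshift q) (m : 'rV[hol]_(N * N)) *m End_mx A by [].
rewrite -[in LHS](vec_mxK (m : 'rV[hol]_(N * N))) map_mxvec End_mxE.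
exact: mxvecK.
Qed.

Definition mx2 (a b c d : hol) : 'M[hol]_2 :=
  \matrix_(i, j) if i == 0 then (if j == 0 then a else b)
                 else (if j == 0 then c else d).

Lemma sum2 (F : 'I_2 -> hol) : \sum_i F i = F 0 + F 1.
Proof. by rewrite big_ord_recl big_ord1; congr (_ + F _); exact: val_inj. Qed.

Lemma lower_mulmx (X Y : 'M[hol]_2) : X 0 1 = 0 -> Y 0 1 = 0 ->
  [/\ (X *m Y) 0 1 = 0, (X *m Y) 0 0 = X 0 0 * Y 0 0
    & (X *m Y) 1 1 = X 1 1 * Y 1 1].
Proof.
by move=> X0 Y0; rewrite !mxE !sum2 X0 Y0 !mulr0 !mul0r !addr0 add0r.
Qed.

Lemma ord2P (P : 'I_2 -> Prop) : P 0 -> P 1 -> forall i, P i.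
Proof.
move=> P0 P1 [[|[|//]] i]; first by rewrite (_ : Ordinal i = 0) //; exact: val_inj.
by rewrite (_ : Ordinal i = 1) //; exact: val_inj.
Qed.

(* A rank 2 bundle of row vectors with determinant 1 and the flag spanned by  *)
(* e_1, which is a subbundle when the upper right entry of the multiplier     *)
(* vanishes.                                                                  *)
Record parabolic := MkParabolic {
  par_mult :> LGL 2;
  par_det : \det par_mult = 1;
  par_flag : par_mult 0 1 = 0 }.

Section Parabolic.
Variable xi : parabolic.

Let EndV := bundle (End_mult xi).

Lemma par_inv_flag : invmx xi 0 1 = 0.
Proof.
have /matrixP inv := mulmxV (LGL_unit xi).
have := inv 0 0; have := inv 0 1; rewrite !mxE !sum2 par_flag !mul0r !addr0 /=.
move=> e01 e00; rewrite -[LHS]mul1r -[1]e00 mulrAC.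
by rewrite e01 mul0r.
Qed.

Definition traceless : {pred EndV} := [pred m : EndV | \tr (vec_mx m) == 0].

Lemma tracelessE (m : EndV) : (m \in traceless) = (\tr (vec_mx m) == 0).
Proof. by []. Qed.

Lemma traceless_zmod_closed : zmod_closed traceless.
Proof.
split=> [|u v]; first by rewrite tracelessE !linear0.
by rewrite !tracelessE => /eqP eu /eqP ev; rewrite (linearB (@vec_mx hol 2 2)) raddfB /= eu ev subr0.
Qed.
HB.instance Definition _ := GRing.isZmodClosed.Build EndV traceless traceless_zmod_closed.

Lemma traceless_stable (m : EndV) : m \in traceless -> phi EndV m \in traceless.
Proof.
rewrite !tracelessE => /eqP m0; rewrite phi_EndE mxtrace_mulC mulmxA.
by rewrite mulmxV ?LGL_unit// mul1mx trace_map_mx m0 raddf0.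
Qed.

Definition g_par : phimod := sub_phimod (SubMod traceless_stable).

Definition g_mx (m : g_par) : 'M[hol]_2 := vec_mx (\val m).

Lemma g_mxB (u v : g_par) : g_mx (u - v) = g_mx u - g_mx v.
Proof. by rewrite /g_mx !linearB. Qed.

Lemma g_mx_phi (m : g_par) :
  g_mx (phi g_par m) = invmx xi *m map_mx (qshift q) (g_mx m) *m xi.
Proof. exact: phi_EndE. Qed.

Lemma g_mx_tr (m : g_par) : \tr (g_mx m) = 0.
Proof. exact/eqP/(subz_mem m). Qed.

(* In terms of the entries of the matrix with rows (a, b) and (c, d): p is    *)
(* given by b = 0 (preserving the flag), and u by a = b = d = 0.              *)
Definition p_pred : {pred g_par} := [pred m : g_par | g_mx m 0 1 == 0].

Definition u_pred : {pred g_par} :=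
  [pred m : g_par | [&& g_mx m 0 0 == 0, g_mx m 0 1 == 0 & g_mx m 1 1 == 0]].

Lemma p_predE (m : g_par) : (m \in p_pred) = (g_mx m 0 1 == 0).
Proof. by []. Qed.

Lemma u_predE (m : g_par) : (m \in u_pred) =
  [&& g_mx m 0 0 == 0, g_mx m 0 1 == 0 & g_mx m 1 1 == 0].
Proof. by []. Qed.

Lemma p_zmod_closed : zmod_closed p_pred.
Proof.
split=> [|u v]; first by rewrite p_predE /g_mx !linear0 mxE.
by rewrite !p_predE g_mxB !mxE => /eqP -> /eqP ->; rewrite subrr.
Qed.
HB.instance Definition _ := GRing.isZmodClosed.Build g_par p_pred p_zmod_closed.

Lemma u_zmod_closed : zmod_closed u_pred.
Proof.
split=> [|u v]; first by rewrite u_predE /g_mx !linear0 !mxE eqxx.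
rewrite !u_predE g_mxB !mxE => /and3P[/eqP-> /eqP-> /eqP->].
by move=> /and3P[/eqP-> /eqP-> /eqP->]; rewrite subrr eqxx.
Qed.
HB.instance Definition _ := GRing.isZmodClosed.Build g_par u_pred u_zmod_closed.

Lemma g_mx_phi_lower (m : g_par) : g_mx m 0 1 = 0 ->
  [/\ g_mx (phi g_par m) 0 1 = 0,
      g_mx (phi g_par m) 0 0 = invmx xi 0 0 * qshift q (g_mx m 0 0) * xi 0 0
    & g_mx (phi g_par m) 1 1 = invmx xi 1 1 * qshift q (g_mx m 1 1) * xi 1 1].
Proof.
move=> m0; rewrite g_mx_phi.
have mq0 : map_mx (qshift q) (g_mx m) 0 1 = 0 by rewrite mxE m0 raddf0.
have [i01 i00 i11] := lower_mulmx par_inv_flag mq0.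
have [-> -> ->] := lower_mulmx i01 (par_flag xi).
by rewrite i00 i11 !mxE.
Qed.

Lemma p_stable (m : g_par) : m \in p_pred -> phi g_par m \in p_pred.
Proof. by rewrite !p_predE => /eqP /g_mx_phi_lower[-> _ _]. Qed.

Lemma u_stable (m : g_par) : m \in u_pred -> phi g_par m \in u_pred.
Proof.
rewrite !u_predE => /and3P[/eqP m00 /eqP m01 /eqP m11].
have [-> -> ->] := g_mx_phi_lower m01.
by rewrite m00 m11 !raddf0 !mulr0 !mul0r eqxx.
Qed.

Definition p_sub : submod g_par := SubMod p_stable.
Definition u_sub : submod g_par := SubMod u_stable.

Lemma u_sub_p : {subset u_sub <= p_sub}.
Proof. by move=> m; rewrite u_predE p_predE => /and3P[]. Qed.

Definition p_par : phimod := sub_phimod p_sub.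
Definition u_par : phimod := sub_phimod u_sub.
Definition pminus_par : phimod := quot_phimod u_sub.
Definition uminus_par : phimod := quot_phimod p_sub.

(* p_- = g/u is pminus_par and u_- = g/p is uminus_par; tau is induced by the *)
(* projection g/u -> g/p, and delta is the connecting map of                  *)
(* 0 -> p -> g -> g/p -> 0.                                                   *)
Definition tau : H0 pminus_par -> H0 uminus_par := H0_proj u_sub_p.
Definition delta : H0 uminus_par -> H1 p_par := @connecting g_par p_sub.
Definition poisson : H0 pminus_par -> H1 p_par := delta \o tau.

Lemma g_elt_subproof (a b c : hol) :
  (mxvec (mx2 a b c (- a)) : EndV) \in traceless.
Proof. by apply/eqP; rewrite mxvecK /mxtrace sum2 !mxE /= subrr. Qed.

(* The element with rows (a, b) and (c, -a) of g(xi). *)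
Definition g_elt (a b c : hol) : g_par := SubZ (g_elt_subproof a b c).

Lemma p_elt_subproof (a c : hol) : g_elt a 0 c \in p_sub.
Proof. by apply/eqP; rewrite /g_mx mxvecK !mxE. Qed.

Definition p_elt (a c : hol) : p_par := SubZ (p_elt_subproof a c).

(* The classes of the matrix with rows (a, b) and (_, -a) modulo u(xi) and    *)
(* modulo p(xi).                                                              *)
Definition pminus_elt (a b : hol) : pminus_par := quot_class u_sub (g_elt a b 0).
Definition uminus_elt (b : hol) : uminus_par := quot_class p_sub (g_elt 0 b 0).

Lemma g_mx_elt (a b c : hol) : g_mx (g_elt a b c) = mx2 a b c (- a).
Proof. exact: mxvecK. Qed.

Lemma g_mx_inj : injective g_mx.
Proof. by move=> u v /(can_inj vec_mxK) uv; exact: val_inj. Qed.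

Lemma g_eltE (m : g_par) : m = g_elt (g_mx m 0 0) (g_mx m 0 1) (g_mx m 1 0).
Proof.
apply: g_mx_inj; rewrite g_mx_elt; apply/matrixP => i j.
have := g_mx_tr m; rewrite /mxtrace sum2 => /eqP; rewrite addrC addr_eq0 => /eqP tr.
rewrite [RHS]mxE; elim/ord2P: i; elim/ord2P: j => //; exact: tr.
Qed.

Lemma pminus_eltP (y : pminus_par) :
  exists! ab : hol * hol, y = pminus_elt ab.1 ab.2.
Proof.
pose m : g_par := repr (y : {quot u_sub}).
exists (g_mx m 0 0, g_mx m 0 1); split=> [|[a b] /= yab].
  rewrite /= -[LHS](reprK (y : {quot u_sub})) -/m; apply/eqP.
  rewrite /pminus_elt /quot_class -idealrBE [m in m - _]g_eltE u_predE g_mxB !g_mx_elt.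
  by rewrite !mxE /= opprK addNr !subrr eqxx.
have /eqP : m = g_elt a b 0 %[mod {quot u_sub}] by rewrite reprK.
rewrite -idealrBE u_predE g_mxB g_mx_elt !mxE /= => /and3P[].
by rewrite !subr_eq0 => /eqP -> /eqP ->.
Qed.

End Parabolic.

Section Extension.
Variables (eta : Cstar R) (k : nat) (x : hol).
Local Notation t := (zscale eta ^+ k).

(* Extension of xi_0, with multiplier t = (eta z)^k, by its dual: e_1 spans   *)
(* the subbundle xi_0^*.                                                      *)
Definition xi_mx : 'M[hol]_2 := mx2 t^-1 0 (t * x) t.

Lemma xi_det : \det xi_mx = 1.
Proof.
rewrite (expand_det_row _ 0) sum2 /cofactor !det_mx11 !mxE /=.
by rewrite !mul0r addr0 expr0 mul1r mulVr// unitrX// zscale_unit.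
Qed.

Lemma xi_unit : xi_mx \in unitmx.
Proof. by rewrite unitmxE xi_det unitr1. Qed.

Definition xi_LGL : LGL 2 := MkLGL xi_unit.

Lemma xi_flag : xi_LGL 0 1 = 0. Proof. by rewrite mxE. Qed.

Definition xi_par : parabolic := @MkParabolic xi_LGL xi_det xi_flag.

Lemma xi_invmx : invmx xi_par = mx2 t 0 (- (t * x)) t^-1.
Proof.
have tu : t \is a GRing.unit by rewrite unitrX// zscale_unit.
suff h : mx2 t 0 (- (t * x)) t^-1 *m xi_par = 1%:M.
  by rewrite -[RHS]mulmx1 -(mulmxV (LGL_unit xi_par)) mulmxA h mul1mx.
apply/matrixP => i j; rewrite !mxE !sum2 !mxE /=.
elim/ord2P: i; elim/ord2P: j => /=.
- by rewrite divrr// mul0r addr0.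
- by rewrite mulr0 mul0r addr0.
- by rewrite mulNr mulrAC divrr// mul1r mulrA mulVr// mul1r addNr.
- by rewrite mulr0 add0r mulVr.
Qed.

(* The multiplier of End(V), in the coordinates (a, b, c, d) of row vectors. *)
Lemma End_xiE (a b c d : hol) :
  mxvec (mx2 a b c d) *m End_mx xi_par =
  mxvec (mx2 (a + t ^+ 2 * x * b) (t ^+ 2 * b)
             (- x * a - t ^+ 2 * x ^+ 2 * b + t ^- 2 * c + x * d)
             (- (t ^+ 2 * x) * b + d)).
Proof.
have tt : t^-1 * t = 1 by rewrite mulVr// unitrX// zscale_unit.
rewrite End_mxE xi_invmx; congr mxvec.
apply/matrixP => i j; rewrite !mxE !sum2 !mxE !sum2 !mxE /=.
have -> : t ^- 2 = t^-1 ^+ 2 by rewrite exprVn.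
move: (t^-1) tt => u; move: (t) => v uv.
by elim/ord2P: i; elim/ord2P: j => /=; ring: uv.
Qed.

Lemma phi_g_elt (a b c : hol) :
  g_mx (phi (g_par xi_par) (g_elt xi_par a b c)) =
  mx2 (qshift q a + t ^+ 2 * x * qshift q b) (t ^+ 2 * qshift q b)
      (- x * qshift q a - t ^+ 2 * x ^+ 2 * qshift q b + t ^- 2 * qshift q c
         + x * qshift q (- a))
      (- (t ^+ 2 * x) * qshift q b + qshift q (- a)).
Proof.
rewrite g_mx_phi g_mx_elt -[LHS]mxvecK -End_mxE -[RHS]mxvecK -End_xiE.
congr (vec_mx (mxvec _ *m _)).
by apply/matrixP => i j; rewrite !mxE; elim/ord2P: i; elim/ord2P: j.
Qed.

(* H^0(p_-): the classes with (eta z)^(2k) b_q = b and a_q - a = - b x. *)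
Lemma pminus_elt_fixed (a b : hol) :
  (pminus_elt xi_par a b \in fixed (M := pminus_par xi_par)) =
  (t ^+ 2 * qshift q b == b) && (qshift q a - a == - b * x).
Proof.
have -> : (pminus_elt xi_par a b \in fixed (M := pminus_par xi_par)) =
   (phi (g_par xi_par) (g_elt xi_par a b 0) - g_elt xi_par a b 0
      \in u_sub xi_par).
  by rewrite idealrBE -quot_phi_pi.
rewrite u_predE g_mxB phi_g_elt g_mx_elt !mxE /= raddfN.
rewrite [X in [&& _, X & _]]subr_eq0 andbCA; case: eqP => //= tb.
have -> : t ^+ 2 * x * qshift q b = b * x by rewrite mulrAC tb.
have -> : - (t ^+ 2 * x) * qshift q b = - (b * x) by rewrite mulNr mulrAC tb.
rewrite -[X in X && _]subr_eq0 -[X in _ && X]oppr_eq0 subr0.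
have -> : - (- (b * x) - qshift q a - - a) = qshift q a + b * x - a by ring.
rewrite andbb -[RHS]subr_eq0; congr (_ == _); ring.
Qed.

End Extension.

End Bundles.

Arguments tau {R} q xi.
Arguments delta {R} q xi.
Arguments poisson {R} q xi.

(* Main.v *)
Require Import Defs.
From mathcomp Require Import all_boot all_order all_algebra.
From mathcomp Require Import all_classical all_reals all_analysis.
From mathcomp Require Import complex ring.

Set Implicit Arguments.
Unset Strict Implicit.
Unset Printing Implicit Defensive.

Import Order.TTheory GRing.Theory Num.Theory.
Import Quotient.

Local Open Scope ring_scope.

(** Lift [s] to the matrix with rows (a, b') and (0, -a). With t = (eta z)^k, t^2 b'_q = b' and a_q
    = a - b' x, applying phi - 1 leaves only the lower left entry -2 a_q x - b' x^2 = (b' x - 2 a)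
    x. *)

(* Two lifts differ by some n in S, which changes phi m - m by the coboundary *)
(* phi n - n.                                                                 *)
Lemma connecting_lift (M : phimod) (S : submod M) (s : H0 (quot_phimod S))
    (m : M) (w : sub_phimod S) :
  subz_val s = quot_class S m -> subz_val w = phi M m - m ->
  connecting s = H1_class w.
Proof.
move=> sm wm.
have nS : repr (\val s : {quot S}) - m \in S.
  by rewrite idealrBE reprK; apply/eqP.
apply/eqP; rewrite /connecting /H1_class -idealrBE; apply/asboolP.
exists (SubZ nS); apply: val_inj => /=.
by rewrite wm (raddfB (phi M)) !opprD !opprK addrACA.
Qed.

Theorem proposition25 (R : realType) (q eta : Cstar R) (k : nat) (x : hol R)
    (q_lt1 : `|q : R[i]| < 1) (k_gt0 : (1 <= k)%N) :
  let xi := xi_par eta k x in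
  poisson q xi = delta q xi \o tau q xi /\
  forall (s : H0 (pminus_par q xi)) (a b' : hol R),
    subz_val s = pminus_elt q xi a b' ->
    subz_val (tau q xi s) = uminus_elt q xi b' /\
    delta q xi (tau q xi s) = H1_class (p_elt q xi 0 ((b' * x - 2 * a) * x)).
Proof.
move=> xi; split=> // s a b' sab.
(* Lifting with the diagonal (a, -a), not 0, makes phi m - m strictly lower   *)
(* triangular, since a_q - a = - b' x.                                        *)
have tau_lift : subz_val (tau q xi s) =
    quot_class (p_sub q xi) (g_elt q xi a b' 0).
  rewrite -(quot_proj_class (@u_sub_p R q xi)) -[quot_class _ _]sab; reflexivity.
split.
  (* Modulo p only the upper right entry counts, so the diagonal drops out. *)
  rewrite tau_lift; apply/eqP.
  by rewrite /uminus_elt /quot_class -idealrBE p_predE g_mxB !g_mx_elt !mxE /= subrr.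
(* Invariance modulo u yields both functional equations. *)
have := subz_mem s; rewrite sab pminus_elt_fixed => /andP[/eqP tb /eqP ta].
apply: (connecting_lift tau_lift); apply: g_mx_inj.
have qa : qshift q a = a - b' * x by rewrite -[LHS](subrK a) ta mulNr addrC.
rewrite /= g_mxB phi_g_elt !g_mx_elt (raddf0 (qshift q)) (raddfN (qshift q)) /= qa.
apply/matrixP => i j; rewrite !mxE mulr0.
move: tb; move: (zscale eta ^+ k) => t tb.
by elim/ord2P: i; elim/ord2P: j => /=; ring: tb.
Qed.
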